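(* Let $\alpha\in(0,1)$ and $b>0$. Let $\mathbf{X}=(X_1,\dots,X_n)$ be a random vector taking values in $[-b,b]^n$ and let $Y$ be a discrete random variable taking values in a countable set $\mathcal{Y}$. For a parameter $\theta\in\mathbb{R}^k$, let $f_Y(y;\theta)$ be the probability mass function of $Y$ and $f_{\mathbf{X}|Y}(\mathbf{x}|y;\theta)$ the probability density function of $\mathbf{X}$ given $Y=y$. Let $r:[-b,b]^n\times\mathcal{Y}\to\mathbb{R}$ be bounded, and set $R=r(\mathbf{X},Y)$. Assume: (1) $R$ is a continuous random variable for all $\theta$; for all $\theta$ and $1\le j\le k$ the derivatives $\frac{\partial}{\partial\theta_j}\nu_\alpha(R;\theta)$ and $\frac{\partial}{\partial\theta_j}\Phi_\alpha(R;\theta)$ are well defined and bounded; and $\frac{\partial\log f_{\mathbf{X}|Y}(\mathbf{x}|y;\theta)}{\partial\theta_j}$ and $\frac{\partial\log f_Y(y;\theta)}{\partial\theta_j}$ exist and are bounded for all $\mathbf{x}$, $y$ and $\theta$; (2) for all $y\in\mathcal{Y}$ and all $\theta$, the level set $\mathcal{D}_{y;\theta}=\{\mathbf{x}\in[-b,b]^n: r(\mathbf{x},y)\le\nu_\alpha(R;\theta)\}$ may be written as a finite union $\mathcal{D}_{y;\theta}=\bigcup_{i=1}^{L_{y;\theta}}D^i_{y;\theta}$ of disjoint, closed, connected components $D^i_{y;\theta}$, each with positive measure. Then, for all $\theta$ and $1\le j\le k$, $$\frac{\partial}{\partial\theta_j}\Phi_\alpha(R;\theta)=\mathbb{E}^{\theta}\left[\left.\left(\frac{\partial\log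 f_Y(Y;\theta)}{\partial\theta_j}+\frac{\partial\log f_{\mathbf{X}|Y}(\mathbf{X}|Y;\theta)}{\partial\theta_j}\right)\bigl(R-\nu_\alpha(R;\theta)\bigr)\,\right|\,R\le\nu_\alpha(R;\theta)\right].$$
   Context: A random variable $R$ is called continuous if its cumulative distribution function $F_R(z)=\Pr(R\le z)$ is everywhere continuous. For $\alpha\in(0,1)$, the $\alpha$-Value-at-Risk (the $\alpha$-quantile) of $R$ is $\nu_\alpha(R)=\inf\{z:F_R(z)\ge\alpha\}$, and the $\alpha$-Conditional-Value-at-Risk (CVaR) of $R$ is $\Phi_\alpha(R)=\mathbb{E}[R\mid R\le\nu_\alpha(R)]$. When the distribution depends on a parameter $\theta$, $\nu_\alpha(R;\theta)$ and $\Phi_\alpha(R;\theta)$ denote these quantities when the parameter is $\theta$, and $\mathbb{E}^\theta$ denotes expectation under the distribution with parameter $\theta$. *)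

(* Defs.v *)
From HB Require Import structures.
From mathcomp Require Import all_boot all_order all_algebra.
From mathcomp Require Import all_classical all_reals all_analysis.

Set Implicit Arguments.
Unset Strict Implicit.
Unset Printing Implicit Defensive.

Import Order.TTheory GRing.Theory Num.Theory.
Import numFieldNormedType.Exports.

Local Open Scope classical_set_scope.
Local Open Scope ring_scope.

Definition measure_row_display : measure_display -> measure_display.
Proof. exact. Qed.

(* Product sigma-algebra on row vectors, as for n.-tuple T in the library; for
   T = R it is the Borel sigma-algebra of R^n. *)
Section measurable_row.
Context {d} {T : measurableType d}.
Variable n : nat.

Let coors : 'I_n -> 'rV[T]_n -> T := fun i x => x ord0 i.

Let row_set0 : g_sigma_preimage coors set0.
Proof. exact: sigma_algebra0. Qed.

Let row_setC A : g_sigma_preimage coors A -> g_sigma_preimage coors (~` A).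
Proof. exact: sigma_algebraC. Qed.

Let row_bigcup (F : _^nat) : (forall i, g_sigma_preimage coors (F i)) ->
  g_sigma_preimage coors (\bigcup_i (F i)).
Proof. exact: sigma_algebra_bigcup. Qed.

HB.instance Definition _ := @isMeasurable.Build (measure_row_display d)
  'rV[T]_n (g_sigma_preimage coors) row_set0 row_setC row_bigcup.

Lemma measurable_coord (i : 'I_n) :
  measurable_fun [set: 'rV[T]_n] (fun x : 'rV[T]_n => x ord0 i).
Proof.
move=> _ Y mY; rewrite setTI; apply: sub_sigma_algebra => /=.
rewrite -bigcup_seq/=; exists i => /=; first by rewrite mem_index_enum.
by exists Y => //; rewrite setTI.
Qed.

Lemma measurable_fun_rowP d' (T' : measurableType d') (f : T' -> 'rV[T]_n) :
  (forall i, measurable_fun [set: T'] (fun x => f x ord0 i)) ->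
  measurable_fun [set: T'] f.
Proof.
move=> mf; apply: (@measurability _ _ _ _ setT f
  (\big[setU/set0]_(i < n) preimage_set_system setT (coors i) measurable)) => //.
move=> _ [B + <-]; rewrite -bigcup_seq => -[i _ [C mC <-]].
rewrite setTI preimage_setI preimage_setT setTI.
by have := mf i measurableT C mC; rewrite setTI.
Qed.

End measurable_row.

Lemma product_sigma_finite d1 d2 (T1 : measurableType d1)
    (T2 : measurableType d2) (R : realType)
    (m1 : {sigma_finite_measure set T1 -> \bar R})
    (m2 : {sigma_finite_measure set T2 -> \bar R}) :
  sigma_finite setT (m1 \x m2)%E.
Proof.
have /sigma_finiteP[F [TF ndF Foo]] := sigma_finiteT m1.
have /sigma_finiteP[G [TG ndG Goo]] := sigma_finiteT m2.
exists (fun n => F n `*` G n).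
 rewrite -setXTT TF TG predeqE => -[x y]; split.
    move=> [/= [n _ Fnx] [k _ Gky]]; exists (maxn n k) => //; split.
    - by move: x Fnx; exact/subsetPset/ndF/leq_maxl.
    - by move: y Gky; exact/subsetPset/ndG/leq_maxr.
  by move=> [n _ []/= ? ?]; split; exists n.
move=> k; have [? ?] := Foo k; have [? ?] := Goo k.
split; first exact: measurableX.
by rewrite product_measure1E// lte_mul_pinfty// ge0_fin_numE.
Qed.

Section lebesgue_row.
Context {R : realType}.

Definition cons_row n (p : R * 'rV[R]_n) : 'rV[R]_n.+1 :=
  row_mx (p.1%:M : 'rV[R]_1) p.2.

Lemma cons_row_ord0 n (p : R * 'rV[R]_n) : cons_row p ord0 ord0 = p.1.
Proof.
rewrite /cons_row (_ : ord0 = lshift n (ord0 : 'I_1)); last exact/val_inj.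
by rewrite [LHS](@row_mxEl _ 1 1 n) mxE eqxx mulr1n.
Qed.

Lemma cons_row_lift n (p : R * 'rV[R]_n) i :
  cons_row p ord0 (lift ord0 i) = p.2 ord0 i.
Proof.
rewrite /cons_row (_ : lift ord0 i = rshift 1 i); last exact/val_inj.
by rewrite [LHS](@row_mxEr _ 1 1 n).
Qed.

Definition uncons_row n (v : 'rV[R]_n.+1) : R * 'rV[R]_n :=
  (v ord0 ord0, \row_i v ord0 (lift ord0 i)).

Lemma cons_rowK n : cancel (@cons_row n) (@uncons_row n).
Proof.
case=> x v; rewrite /uncons_row cons_row_ord0; congr (_, _).
by apply/rowP => i; rewrite mxE cons_row_lift.
Qed.

Lemma measurable_cons_row n : measurable_fun setT (@cons_row n).
Proof.
apply: measurable_fun_rowP => i; case: (unliftP ord0 i) => [j|] ->.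
  under eq_fun do rewrite cons_row_lift.
  exact: (measurableT_comp (measurable_coord j) measurable_snd).
under eq_fun do rewrite cons_row_ord0.
exact: measurable_fst.
Qed.

Lemma measurable_uncons_row n : measurable_fun setT (@uncons_row n).
Proof.
apply/measurable_fun_pairP; split; first exact: measurable_coord.
apply: measurable_fun_rowP => i.
rewrite [X in measurable_fun _ X](_ : _ =
    (fun v : 'rV[R]_n.+1 => v ord0 (lift ord0 i))).
  exact: measurable_coord.
by apply/funext => v; rewrite /uncons_row /= mxE.
Qed.

Section lebesgue_cons.
Variables (n : nat) (mu : {sigma_finite_measure set 'rV[R]_n -> \bar R}).

Definition lebesgue_cons : set 'rV[R]_n.+1 -> \bar R :=
  pushforward (lebesgue_measure \x mu)%E (@cons_row n).

Let lebesgue_cons0 : lebesgue_cons set0 = 0%E.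
Proof. by rewrite /lebesgue_cons /pushforward preimage_set0 measure0. Qed.

Let lebesgue_cons_ge0 A : (0 <= lebesgue_cons A)%E.
Proof. by rewrite /lebesgue_cons /pushforward measure_ge0. Qed.

Let mpre A : measurable A -> measurable (@cons_row n @^-1` A).
Proof. by move=> mA; rewrite -[X in measurable X]setTI; exact: measurable_cons_row. Qed.

Let lebesgue_cons_sigma_additive : semi_sigma_additive lebesgue_cons.
Proof.
move=> F mF tF mUF; rewrite /lebesgue_cons /pushforward preimage_bigcup.
apply: measure_semi_sigma_additive.
- by move=> k; exact: mpre.
- apply/trivIsetP => /= i j _ _ ij; rewrite -preimage_setI.
  by move/trivIsetP : tF => /(_ _ _ _ _ ij) ->//; rewrite preimage_set0.
- by rewrite -preimage_bigcup; exact: mpre.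
Qed.

HB.instance Definition _ := isMeasure.Build _ _ _ lebesgue_cons
  lebesgue_cons0 lebesgue_cons_ge0 lebesgue_cons_sigma_additive.

Let lebesgue_cons_sigma_finite : sigma_finite setT lebesgue_cons.
Proof.
have [F TF Foo] : sigma_finite setT (lebesgue_measure \x mu)%E.
  exact: product_sigma_finite.
exists (fun k => @uncons_row n @^-1` F k).
  by rewrite -preimage_bigcup -TF preimage_setT.
move=> k; have [mF Fk] := Foo k; split.
  by rewrite -[X in measurable X]setTI; exact: measurable_uncons_row.
rewrite /lebesgue_cons /pushforward -comp_preimage.
by rewrite (_ : _ \o _ = id)//; apply/funext => p; exact: cons_rowK.
Qed.

HB.instance Definition _ := Measure_isSigmaFinite.Build _ _ _ lebesgue_cons
  lebesgue_cons_sigma_finite.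

End lebesgue_cons.

(* Lebesgue measure on R^n, as the n-fold product of the Lebesgue measure of the
   line; for n = 0 it is the unit mass on the only point. *)
Fixpoint lebesgue_measure_row n : {sigma_finite_measure set 'rV[R]_n -> \bar R} :=
  if n is m.+1 then lebesgue_cons (lebesgue_measure_row m)
  else \d_(0 : 'rV[R]_0).

Lemma lebesgue_measure_row_box n (A : 'I_n -> set R) :
  (forall i, measurable (A i)) ->
  lebesgue_measure_row n [set x | forall i, A i (x ord0 i)] =
  (\prod_(i < n) lebesgue_measure (A i))%E.
Proof.
elim: n A => [|n IHn] A mA.
  rewrite big_ord0 /= diracE mem_set//; by case.
rewrite big_ord_recl -IHn//= /lebesgue_cons /pushforward.
rewrite (_ : _ @^-1` _ =
    A ord0 `*` [set x : 'rV[R]_n | forall i, A (lift ord0 i) (x ord0 i)]).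
  rewrite product_measure1E//; first exact: mA.
  rewrite (_ : [set x | _] = \bigcap_(i in [set: 'I_n])
      ((fun x : 'rV[R]_n => x ord0 i) @^-1` A (lift ord0 i))); last first.
    by apply/seteqP; split=> x /= Ax i; [move=> _|]; exact: Ax.
  apply: fin_bigcap_measurable => // i _.
  by rewrite -[X in measurable X]setTI; exact: measurable_coord.
apply/seteqP; split=> [[x v] /= Av|[x v] /= [Ax Av] i].
  split=> [|i]; first by have := Av ord0; rewrite cons_row_ord0.
  by have := Av (lift ord0 i); rewrite cons_row_lift.
by case: (unliftP ord0 i) => [j|] ->; rewrite ?cons_row_ord0 ?cons_row_lift//=.
Qed.

End lebesgue_row.

Definition cube {R : realType} (b : R) n : set 'rV[R]_n :=
  [set x | forall i, - b <= x ord0 i <= b].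

Notation "'partial_ j f" := (derive f ^~ (delta_mx ord0 j))
  (at level 10, j at level 8, f at next level) : ring_scope.

Section conditioning.
Context {d} {T : measurableType d} {R : realType} (P : probability T R).

(* Conditioning on an event of positive probability. *)
Definition cond_prob (A B : set T) : \bar R :=
  (P (A `&` B) * (fine (P B))^-1%:E)%E.

Definition cond_expectation (Z : T -> R) (B : set T) : R :=
  (\int[P]_(w in B) Z w)%R / fine (P B).

End conditioning.

Section value_at_risk.
Context {d} {T : measurableType d} {R : realType}.

Definition continuous_rv (P : probability T R) (Z : {RV P >-> R}) :=
  continuous (cdf Z).

(* For 0 < alpha < 1 this set is nonempty and bounded below, so that inf is the
   actual infimum. *)
Definition VaR (alpha : R) (P : probability T R) (Z : {RV P >-> R}) : R :=
  inf [set z | (alpha%:E <= cdf Z z)%E].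

Definition CVaR (alpha : R) (P : probability T R) (Z : {RV P >-> R}) : R :=
  cond_expectation P Z [set w | Z w <= VaR alpha Z].

End value_at_risk.

(* f is a density of X given the event E under P, for X valued in D; it is taken
   with respect to Lebesgue measure on D, and its values outside D are ignored. *)
Definition is_cond_pdf {d} {T : measurableType d} {R : realType}
    (P : probability T R) n (D : set 'rV[R]_n) (X : T -> 'rV[R]_n)
    (E : set T) (f : 'rV[R]_n -> R) :=
  [/\ measurable_fun D f, forall x, D x -> 0 <= f x &
      forall A, measurable A ->
        cond_prob P (X @^-1` A) E =
        (\int[lebesgue_measure_row n]_(x in A `&` D) (f x)%:E)%E].

(* Nonempty pairwise disjoint closed connected sets, finitely many, are
   necessarily the connected components of their union. *)
Definition has_closed_components {R : realType} n (A : set 'rV[R]_n) :=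
  exists (L : nat) (D : 'I_L -> set 'rV[R]_n),
    [/\ A = \bigcup_i D i, trivIset setT D &
        forall i, [/\ closed (D i), connected (D i) &
                      (0 < lebesgue_measure_row n (D i))%E]].

(* Main.v *)
Require Import Defs.
From HB Require Import structures.
From mathcomp Require Import all_boot all_order all_algebra.
From mathcomp Require Import all_classical all_reals all_analysis.
From mathcomp Require Import measurable_realfun.
From mathcomp Require Import ring lra.

Set Implicit Arguments.
Unset Strict Implicit.
Unset Printing Implicit Defensive.

Import Order.TTheory GRing.Theory Num.Theory.
Import numFieldNormedType.Exports.

Local Open Scope classical_set_scope.
Local Open Scope ring_scope.

(* An envelope argument.  For every [v] and [t],
     alpha * Phi t >= alpha * v - E^t [max (v - Z) 0],
   with equality when [v = nu t].  Fix [v = nu theta]: the two sides, as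
   functions of [t], are ordered and agree at [theta], so their derivatives along
   any direction agree there.  The threshold [v] no longer moves with [t], and
   E^t [max (v - Z) 0] = E^theta [max (v - Z) 0 * likelihood ratio] is
   differentiated under the expectation: the score is bounded, hence by the mean
   value theorem so are the difference quotients of the likelihood ratio, and
   dominated convergence applies. *)

(** * Directional derivatives and difference quotients of exponentials *)

Section directional_derivative.
Context {R : realType} {V : normedModType R}.
Implicit Types (f : V -> R) (a v : V).

(** Both derivatives are limits of the same function of [h], so one-variable calculus applies along
    the line. *)
Lemma is_derive_line f a v (s : R) : derivable f (s *: v + a) v ->
  is_derive s (1 : R) (fun u : R => f (u *: v + a)) ('D_v f (s *: v + a)).
Proof.
have E : (fun h : R => h^-1 *:
      (((fun u : R => f (u *: v + a)) \o shift s) (h *: 1) - f (s *: v + a))) =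
    (fun h : R => h^-1 *: ((f \o shift (s *: v + a)) (h *: v) - f (s *: v + a))).
  by apply/funext => h /=; rewrite -[h *: 1]/(h * 1) mulr1 scalerDl addrA.
by move=> df; split; rewrite /derivable/derive E.
Qed.

(** The mean value theorem on the segment between [0] and [s]. Derivability along the single
    direction [v] suffices. *)
Lemma lipschitz_line f a v (C s : R) : (forall x, derivable f x v) ->
  (forall x, `|'D_v f x| <= C) -> `|f (s *: v + a) - f a| <= C * `|s|.
Proof.
move=> df dfC; pose g u := f (u *: v + a).
have dg (u : R) : is_derive u (1 : R) g ('D_v f (u *: v + a)).
  exact: is_derive_line.
have cg u1 u2 : {within `[u1, u2], continuous g}.
  apply: continuous_subspaceT => u; apply/differentiable_continuous.
  by apply/derivable1_diffP; apply: ex_derive.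
have -> : f a = g 0 by rewrite /g scale0r add0r.
rewrite -/(g s); have [s0|s0] := leP 0 s.
  have [c _ ->] := MVT_segment s0 (fun u _ => dg u) (cg 0 s).
  by rewrite subr0 normrM ler_wpM2r.
have [c _ E] := MVT_segment (ltW s0) (fun u _ => dg u) (cg s 0).
by rewrite distrC E sub0r normrM normrN ler_wpM2r.
Qed.

(** A sequence of nonzero terms tending to 0 converges for the punctured filter [0^']. The
    sequential form is the one that dominated convergence needs. *)
Lemma cvg_difference_quotient f a v (h : R^nat) : derivable f a v ->
  h @ \oo --> 0 -> (forall m, h m != 0) ->
  (fun m => (h m)^-1 * (f (h m *: v + a) - f a)) @ \oo --> 'D_v f a.
Proof.
move=> df h0 hn0.
have hd : h @ \oo --> 0^'.
  move=> A; rewrite /dnbhs /within /= => /h0 [N _ NA]; exists N => // m Nm.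
  exact: NA.
exact: (cvg_comp _ _ hd df).
Qed.

End directional_derivative.

(** Both signs reduce to [1 + x <= expR x]: divide by [expR u] when [u >= 0]; when [u < 0] the
    factor [expR |u|] is at least 1. *)
Lemma ler_norm_expRB1 (R : realType) (u : R) : `|expR u - 1| <= `|u| * expR `|u|.
Proof.
have [u0|u0] := leP 0 u.
  rewrite (ger0_norm u0) ger0_norm; last by rewrite subr_ge0 -expR0 ler_expR.
  rewrite -ler_pdivrMr ?expR_gt0// -expRN mulrBl mul1r -expRD subrr expR0.
  by rewrite lerBlDr -lerBlDl expR_ge1Dx.
rewrite (ltr0_norm u0) ler0_norm; last by rewrite subr_le0 -expR0 ler_expR ltW.
rewrite opprB; apply: (@le_trans _ _ (- u)).
  by rewrite lerBlDr -lerBlDl opprK expR_ge1Dx.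
by rewrite ler_peMr ?oppr_ge0 ?(ltW u0)// -expR0 ler_expR oppr_ge0 ltW.
Qed.

(** With [g] a log-likelihood, the exponential is a likelihood ratio. The bound does not depend on
    [s], so it can serve as the dominating constant; [|s| <= 1] keeps the exponent below [C]. *)
Lemma expR_difference_quotient_bound (R : realType) (V : normedModType R)
    (g : V -> R) (a v : V) (C s : R) : (forall x, derivable g x v) ->
  (forall x, `|'D_v g x| <= C) -> `|s| <= 1 ->
  `|s^-1 * (expR (g (s *: v + a) - g a) - 1)| <= C * expR C.
Proof.
move=> dg gC s1; have C0 : 0 <= C by exact: le_trans (gC a).
(* Since [0^-1 = 0], the quotient at [s = 0] is 0. *)
have [->|s0] := eqVneq s 0.
  by rewrite invr0 mul0r normr0 mulr_ge0 ?expR_ge0.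
have gs := lipschitz_line a s dg gC.
rewrite normrM normfV ler_pdivrMl ?normr_gt0//.
rewrite (le_trans (ler_norm_expRB1 _))// mulrA (mulrC `|s|) ler_pM ?expR_ge0//.
by rewrite ler_expR (le_trans gs)// ler_piMr.
Qed.

(** Chain rule at 0, where the exponent vanishes and [expR] has derivative 1: the likelihood ratio
    has the score as its derivative at the base point. *)
Lemma cvg_expR_difference_quotient (R : realType) (V : normedModType R)
    (g : V -> R) (a v : V) (h : R^nat) : derivable g a v ->
  h @ \oo --> 0 -> (forall m, h m != 0) ->
  (fun m => (h m)^-1 * (expR (g (h m *: v + a) - g a) - 1)) @ \oo --> 'D_v g a.
Proof.
move=> dg h0 hn0; pose phi (s : R) := expR (g (s *: v + a) - g a).
have dphi : is_derive 0 (1 : R) phi ('D_v g a).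
  have dg0 : is_derive 0 (1 : R) (fun s : R => g (s *: v + a) - g a) ('D_v g a).
    have := @is_derive_line R V g a v 0.
    rewrite scale0r add0r => /(_ dg) dl.
    by apply: is_derive_eq; rewrite subr0.
  have := @is_derive1_comp _ expR _ 0 _ _ (is_derive_expR _) dg0.
  by rewrite scale0r add0r subrr expR0 mul1r.
have := @cvg_difference_quotient _ _ phi 0 1 h
  (@ex_derive _ _ _ _ _ _ _ dphi) h0 hn0.
rewrite derive_val; apply: cvg_trans; apply: near_eq_cvg; apply: nearW => m.
by rewrite addr0 -[h m *: 1]/(h m * 1) mulr1 /phi scale0r add0r subrr expR0.
Qed.

(** * Integration against a measure with a density *)

Section density.
Local Open Scope ereal_scope.
Context d (T : measurableType d) (R : realType).
Variables (mu nu : {measure set T -> \bar R}) (f : T -> R).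
Hypothesis mf : measurable_fun setT f.
Hypothesis f0 : forall x, (0 <= f x)%R.
Hypothesis nuE : forall A, measurable A -> nu A = \int[mu]_(x in A) (f x)%:E.

Import HBNNSimple.

(** Decompose [h] over its level sets and apply [nuE] to each of them. *)
Lemma sintegral_density (h : {nnsfun T >-> R}) :
  sintegral nu h = \int[mu]_x ((h x)%:E * (f x)%:E).
Proof.
rewrite sintegralE.
have mEf : measurable_fun setT (EFin \o f) by exact/measurable_EFinP.
have Ef0 x : 0 <= (f x)%:E by rewrite lee_fin.
transitivity (\int[mu]_x
    (\sum_(r \in range h) (r * \1_(h @^-1` [set r]) x)%:E * (f x)%:E)); last first.
  apply: eq_integral => x _.
  rewrite -ge0_mule_fsuml => [|r]; last exact: nnfun_muleindic_ge0.
  by rewrite fsumEFin// -fimfunE.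
rewrite ge0_integral_fsum//; last 2 first.
- move=> r; apply: emeasurable_funM => //.
  exact/measurable_EFinP/measurable_funM.
- by move=> r x _; rewrite mule_ge0// nnfun_muleindic_ge0.
apply: eq_fsbigr => r rh.
have r0 : (0 <= r)%R by move: rh; rewrite inE => -[x _ <-].
under eq_integral do rewrite EFinM -muleA.
rewrite ge0_integralZl//; last 2 first.
- by apply: emeasurable_funM => //; exact/measurable_EFinP/measurable_indic.
- by move=> x _; rewrite mule_ge0// lee_fin.
rewrite nuE//; congr (_ * _).
rewrite integral_mkcond; apply: eq_integral => x _.
by rewrite epatch_indic muleC.
Qed.

(** Approximate [g] from below by simple functions and apply monotone convergence on both sides. *)
Lemma ge0_integral_density (g : T -> \bar R) : measurable_fun setT g ->
  (forall x, 0 <= g x) -> \int[nu]_x g x = \int[mu]_x (g x * (f x)%:E).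
Proof.
move=> mg g0; pose h := nnsfun_approx measurableT mg.
have h_g x : (h m x)%:E @[m --> \oo] --> g x by exact: cvg_nnsfun_approx.
have nd_h x : {homo (fun m => (h m x)%:E) : p q / (p <= q)%N >-> p <= q}.
  by move=> p q pq; rewrite lee_fin; exact/lefP/nd_nnsfun_approx.
transitivity (limn (fun m => \int[nu]_x (h m x)%:E)).
  rewrite -monotone_convergence//.
  - by apply: eq_integral => x _; apply/esym/cvg_lim.
  - by move=> m; exact/measurable_EFinP.
  - by move=> m x _; rewrite lee_fin.
under eq_fun do rewrite integralT_nnsfun sintegral_density.
rewrite -monotone_convergence//.
- apply: eq_integral => x _; apply/cvg_lim => //.
  exact: cvgeZr.
- move=> m; apply: emeasurable_funM => //; exact/measurable_EFinP.
- by move=> m x _; rewrite mule_ge0// lee_fin.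
- by move=> x _ p q pq; apply: lee_wpmul2r; [rewrite lee_fin|exact: nd_h].
Qed.

End density.

(** * The cube and integration against a conditional density *)

Lemma measurable_cube (R : realType) (b : R) n : measurable (cube b (n := n)).
Proof.
rewrite (_ : cube b (n := n) = \bigcap_(i in [set: 'I_n])
    ((fun x : 'rV[R]_n => x ord0 i) @^-1` `[- b, b])); last first.
  apply/seteqP; split=> x /= xb i; first by move=> _; rewrite /= in_itv/= xb.
  by have := xb i I; rewrite /= in_itv.
apply: fin_bigcap_measurable => // i _.
by rewrite -[X in measurable X]setTI; exact: measurable_coord.
Qed.

Section conditional_density.
Context d (T : measurableType d) (R : realType) (P : probability T R).
Variables (n : nat) (D : set 'rV[R]_n) (X : {mfun T >-> 'rV[R]_n}).
Variables (E : set T) (f : 'rV[R]_n -> R).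
Hypothesis mD : measurable D.
Hypothesis XD : forall w, D (X w).
Hypothesis mE : measurable E.
Hypothesis PE : (0 < P E)%E.
Hypothesis pdf_f : is_cond_pdf P D X E f.

(** The unnormalised law of [X] on [E] has density [P E * f] on [D]; undoing the normalisation of
    [cond_prob] produces the factor [P E]. *)
Lemma integral_cond_pdf (g : 'rV[R]_n -> R) : measurable_fun D g ->
    (forall x, D x -> 0 <= g x) ->
  (\int[P]_(w in E) (g (X w))%:E =
   P E * \int[lebesgue_measure_row n]_(x in D) (g x * f x)%:E)%E.
Proof.
case: pdf_f => mf f0 fE mg g0.
have PEfin : P E \is a fin_num by rewrite fin_num_measure.
pose p := fine (P E).
have PEp : P E = p%:E by rewrite fineK.
have p0 : 0 < p by rewrite -lte_fin -PEp.
pose nu := pushforward (mrestr P mE) X.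
(* Extension by 0, since [f] is arbitrary outside [D]. *)
pose q : 'rV[R]_n -> R := ((fun x => p * f x) \_ D).
have mpf : measurable_fun D (fun x => p * f x) by exact: measurable_funM.
have mq : measurable_fun setT q by exact: (measurable_restrictT _ mD).1.
have q0 x : 0 <= q x.
  by rewrite /q patchE; case: ifPn => // /set_mem Dx; rewrite mulr_ge0 ?f0// ltW.
have nuE A : measurable A ->
    nu A = (\int[lebesgue_measure_row n]_(x in A) (q x)%:E)%E.
  move=> mA; have := fE A mA; rewrite /cond_prob -/p => H.
  rewrite /nu /pushforward /mrestr /=.
  transitivity (p%:E * (P (X @^-1` A `&` E) * p^-1%:E))%E.
    by rewrite muleCA -EFinM divff ?gt_eqF// mule1.
  rewrite H -ge0_integralZl//; last 4 first.
  - exact: measurableI.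
  - by apply/measurable_EFinP; apply: measurable_funS mf => //; exact: subIsetr.
  - by move=> x [_ Dx]; rewrite lee_fin f0.
  - by rewrite lee_fin ltW.
  rewrite integral_mkcondr; apply: eq_integral => x _.
  by rewrite /q !patchE; case: ifP.
pose gD := (g \_ D).
have mgD : measurable_fun setT gD by exact: (measurable_restrictT _ mD).1.
have gD0 x : 0 <= gD x.
  by rewrite /gD patchE; case: ifPn => // /set_mem; exact: g0.
have gXD w : gD (X w) = g (X w) by rewrite /gD patchE mem_set.
rewrite PEp -ge0_integralZl//; last 3 first.
- by apply/measurable_EFinP; exact: measurable_funM.
- by move=> x Dx; rewrite lee_fin mulr_ge0 ?g0 ?f0.
- by rewrite lee_fin ltW.
have -> : (\int[P]_(w in E) (g (X w))%:E = \int[nu]_x (gD x)%:E)%E.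
  rewrite ge0_integral_pushforward//; last 2 first.
  - exact/measurable_EFinP.
  - by move=> x _; rewrite lee_fin.
  rewrite preimage_setT.
  (* The restriction of [P] to [E] has density [\1_E] with respect to [P], which turns the integral
     against it into an integral over [E]. *)
  have mE1 : measurable_fun setT (\1_E : T -> R) by exact: measurable_indic.
  have rE A : measurable A -> mrestr P mE A = (\int[P]_(w in A) (\1_E w)%:E)%E.
    by move=> mA; rewrite integral_indic// setIC.
  rewrite (ge0_integral_density mE1 (fun=> ler0n _ _) rE)/=; last 2 first.
  - exact/measurable_EFinP/measurableT_comp.
  - by move=> w; rewrite lee_fin.
  rewrite integral_mkcond; apply: eq_integral => w _.
  by rewrite epatch_indic/= gXD.
rewrite (ge0_integral_density mq q0 nuE)//; last exact/measurable_EFinP.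
rewrite [RHS]integral_mkcond; apply: eq_integral => x _.
by rewrite /gD /q !patchE; case: ifP => _; rewrite -?EFinM ?mulr0// mulrCA.
Qed.

End conditional_density.

(** * Decomposition along the fibres of a discrete variable *)

Section discrete_variable.
Context d (T : measurableType d) (calY : countType) (Y : T -> calY).
Hypothesis mY : forall y, measurable (Y @^-1` [set y]).

Let piece (i : nat) : set T := [set w | pickle (Y w) = i].

Let bigcup_piece : \bigcup_i piece i = setT.
Proof. by apply/seteqP; split=> // w _; exists (pickle (Y w)). Qed.

Let pieceP i : piece i = set0 \/ exists y, piece i = Y @^-1` [set y].
Proof.
have [[w <-]|/set0P/negP/negPn/eqP] := pselect (piece i !=set0); last by left.
right; exists (Y w); apply/seteqP.
split=> u /= [] // uw; last by rewrite /piece /= uw.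
exact: (pcan_inj (@pickleK calY)).
Qed.

Let measurable_piece i : measurable (piece i).
Proof. by have [->//|[y ->]] := pieceP i. Qed.

Lemma measurable_fun_discrete d' (U : measurableType d') (f : T -> U) :
  (forall y, measurable_fun (Y @^-1` [set y]) f) -> measurable_fun setT f.
Proof.
move=> mf; rewrite -bigcup_piece; apply/measurable_fun_bigcup => // i.
by have [->|[y ->]] := pieceP i => //; exact: measurable_fun_set0.
Qed.

(** Sigma-additivity over the fibres. The two measures may differ, as is needed to compare two
    parameters. *)
Lemma eq_ge0_integral_discrete (R : realType) (P Q : {measure set T -> \bar R})
    (f g : T -> \bar R) :
    measurable_fun setT f -> measurable_fun setT g ->
    (forall w, 0 <= f w)%E -> (forall w, 0 <= g w)%E ->
    (forall y, \int[P]_(w in Y @^-1` [set y]) f w =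
               \int[Q]_(w in Y @^-1` [set y]) g w)%E ->
  (\int[P]_w f w = \int[Q]_w g w)%E.
Proof.
move=> mf mg f0 g0 fg; rewrite -bigcup_piece.
have tpiece : trivIset setT piece by move=> i j _ _ [w [/= <- <-]].
rewrite !ge0_integral_bigcup ?bigcup_piece//.
apply: eq_eseriesr => i _.
by have [->|[y ->]] := pieceP i; [rewrite !integral_set0|exact: fg].
Qed.

End discrete_variable.

(** * Change of parameter by the likelihood ratio *)

Section likelihood_ratio.
Context d (T : measurableType d) (R : realType) (n : nat) (calY : countType).
Variables (D : set 'rV[R]_n) (X : {mfun T >-> 'rV[R]_n}) (Y : T -> calY).
Hypothesis mD : measurable D.
Hypothesis XD : forall w, D (X w).
Hypothesis mY : forall y, measurable (Y @^-1` [set y]).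

(** There is no sigma-algebra on [calY]: on each fibre of [Y] the function depends on [X] alone. *)
Lemma measurable_fun_mixed (F : 'rV[R]_n -> calY -> R) :
  (forall y, measurable_fun D (F ^~ y)) ->
  measurable_fun setT (fun w => F (X w) (Y w)).
Proof.
move=> mF; apply: (measurable_fun_discrete mY) => y.
apply: (eq_measurable_fun (fun w => F (X w) y)) => [w /[!inE] ->//|].
apply: measurable_funTS; apply: (measurable_comp mD _ (mF y)) => //.
by move=> _ [w _ <-].
Qed.

(** On the fibre over [y], both sides become the integral over [D] of [G x y * q y * g x y]. The
    ratio of joint densities is written as the exponential of a difference of logarithms, the form
    in which it is later differentiated. *)
Lemma likelihood_ratio (P Q : probability T R) (p q : calY -> R)
    (f g : 'rV[R]_n -> calY -> R) (G : 'rV[R]_n -> calY -> R) :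
    (forall y, P (Y @^-1` [set y]) = (p y)%:E) ->
    (forall y, Q (Y @^-1` [set y]) = (q y)%:E) ->
    (forall y, is_cond_pdf P D X (Y @^-1` [set y]) (f ^~ y)) ->
    (forall y, is_cond_pdf Q D X (Y @^-1` [set y]) (g ^~ y)) ->
    (forall y, 0 < p y) -> (forall y, 0 < q y) ->
    (forall x y, D x -> 0 < f x y) -> (forall x y, D x -> 0 < g x y) ->
    (forall y, measurable_fun D (G ^~ y)) ->
    (forall x y, D x -> 0 <= G x y) ->
  (\int[Q]_w (G (X w) (Y w))%:E =
   \int[P]_w (G (X w) (Y w) *
     expR (ln (q (Y w)) + ln (g (X w) (Y w)) -
           (ln (p (Y w)) + ln (f (X w) (Y w)))))%:E)%E.
Proof.
move=> PY QY pdfP pdfQ p0 q0 f0 g0 mG G0.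
pose H x y := G x y * expR (ln (q y) + ln (g x y) - (ln (p y) + ln (f x y))).
have H0 x y : D x -> 0 <= H x y by move=> Dx; rewrite mulr_ge0 ?expR_ge0 ?G0.
have mf y : measurable_fun D (f ^~ y) by case: (pdfP y).
have mg y : measurable_fun D (g ^~ y) by case: (pdfQ y).
have mln h : measurable_fun D h -> measurable_fun D (fun x => @ln R (h x)).
  by move=> mh; exact: measurableT_comp.
have mH y : measurable_fun D (H ^~ y).
  apply: measurable_funM; first exact: mG.
  apply: measurableT_comp => //; apply: measurable_funB.
    by apply: measurable_funD => //; exact: mln.
  by apply: measurable_funD => //; exact: mln.
rewrite -[RHS]/(\int[P]_w (H (X w) (Y w))%:E)%E.
apply: (eq_ge0_integral_discrete mY).
- exact/measurable_EFinP/measurable_fun_mixed.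
- exact/measurable_EFinP/measurable_fun_mixed.
- by move=> w; rewrite lee_fin G0.
- by move=> w; rewrite lee_fin H0.
move=> y.
transitivity (\int[Q]_(w in Y @^-1` [set y]) (G (X w) y)%:E)%E.
  by apply: eq_integral => w /[!inE] ->.
transitivity (\int[P]_(w in Y @^-1` [set y]) (H (X w) y)%:E)%E; last first.
  by apply: eq_integral => w /[!inE] ->.
rewrite (integral_cond_pdf mD XD (mY y) _ (pdfQ y) (mG y)) ?QY
  ?lte_fin//; last first.
  by move=> x; exact: G0.
rewrite (integral_cond_pdf mD XD (mY y) _ (pdfP y) (mH y)) ?PY
  ?lte_fin//; last first.
  by move=> x; exact: H0.
rewrite -!ge0_integralZl ?lee_fin//; last 6 first.
- by apply/measurable_EFinP; apply: measurable_funM.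
- by move=> x Dx; rewrite lee_fin mulr_ge0 ?H0// ltW ?f0.
- exact: ltW.
- by apply/measurable_EFinP; apply: measurable_funM.
- by move=> x Dx; rewrite lee_fin mulr_ge0 ?G0// ltW ?g0.
- exact: ltW.
apply: eq_integral => x /[!inE] Dx; rewrite -!EFinM /H; congr EFin.
rewrite expRB !expRD !lnK ?posrE ?f0 ?g0//.
by field; rewrite !gt_eqF ?f0.
Qed.

End likelihood_ratio.

(** * Bounded functions under a probability *)

Lemma bounded_integrable d (T : measurableType d) (R : realType)
    (P : probability T R) (f : T -> R) (A : set T) (M : R) : measurable A ->
  measurable_fun setT f -> (forall w, `|f w| <= M) ->
  P.-integrable A (EFin \o f).
Proof.
move=> mA mf fM; apply: (integrableS measurableT) => //.
apply: measurable_bounded_integrable => //.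
  by rewrite (le_lt_trans (probability_le1 P _))// ltry.
exists M; split=> [|x xM w _]; rewrite ?num_real//.
by apply: (le_trans (fM w)); exact: ltW.
Qed.

(** Dominated convergence with a constant bound, which is integrable because the total mass is
    finite. *)
Lemma cvg_Rintegral_bounded d (T : measurableType d) (R : realType)
    (P : probability T R) (f_ : (T -> R)^nat) (f : T -> R) (M : R) :
    (forall m, measurable_fun setT (f_ m)) ->
    (forall w, f_ ^~ w @ \oo --> f w) ->
    (forall m w, `|f_ m w| <= M) ->
  \int[P]_w (f_ m w) @[m --> \oo] --> \int[P]_w (f w).
Proof.
move=> mf_ f_f f_M.
have mf : measurable_fun setT f by exact: (measurable_fun_cvg mf_).
have [] := @dominated_convergence _ _ _ P _ measurableT
  (fun m w => (f_ m w)%:E) (EFin \o f) (cst M%:E).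
- by move=> m; exact/measurable_EFinP.
- exact/measurable_EFinP.
- by apply: aeW => w _; apply: cvg_EFin; [exact: nearW|exact: f_f].
- exact: finite_measure_integrable_cst.
- by apply: aeW => w m _; rewrite lee_fin.
move=> intf _ cf; apply: fine_cvg.
by rewrite fineK ?integrable_fin_num.
Qed.

Lemma ler_norm_hinge (R : realDomainType) (v z C : R) : `|z| <= C ->
  `|Num.max (v - z) 0| <= `|v| + C.
Proof.
move=> zC; have C0 : 0 <= C by exact: le_trans zC.
rewrite ger0_norm ?le_max ?lexx ?orbT// ge_max addr_ge0// andbT.
by rewrite lerD ?ler_norm// (le_trans _ zC)// -normrN ler_norm.
Qed.

(** * Value-at-Risk, CVaR and the expected hinge *)

Section value_at_risk_theory.
Context d (T : measurableType d) (R : realType).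
Variables (P : probability T R) (Z : {RV P >-> R}) (alpha : R).
Hypothesis alpha0 : 0 < alpha.
Hypothesis alpha1 : alpha < 1.
Hypothesis cZ : continuous_rv Z.

Local Notation nu := (VaR alpha Z).

(** If the cdf exceeded [alpha] at [nu], continuity would put a smaller point in [S]; if it fell
    short, it would stay below [alpha] near [nu], where [S] has points. *)
Lemma cdf_VaR : cdf Z nu = alpha%:E.
Proof.
pose S := [set z | (alpha%:E <= cdf Z z)%E].
(* The limits 1 and 0 of the cdf at the two infinities make [S] nonempty and bounded below, so [inf]
   is a true infimum. *)
have S0 : S !=set0.
  have a1 : (alpha%:E < 1)%E by rewrite lte_fin.
  have [M [_ SM]] := cvg_cdfy1 Z (open_ereal_gt' a1).
  by exists (M + 1); apply/ltW/(SM (M + 1)); rewrite ltrDl.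
have lS : has_lbound S.
  have a0 : (0 < alpha%:E)%E by rewrite lte_fin.
  have [M [_ SM]] := cvg_cdfNy0 Z (open_ereal_lt' a0).
  exists M => z Sz; rewrite leNgt; apply/negP => /SM /=.
  by rewrite ltNge => /negP; exact.
apply/eqP; rewrite eq_le; apply/andP; split; rewrite leNgt; apply/negP.
- move=> h; have /nbhs_ballP[e /= e0 He] := cZ (open_ereal_gt' h).
  have : nu <= nu - e / 2.
    apply: ge_inf => //; apply/ltW/He.
    rewrite /ball/= opprB addrC subrK gtr0_norm ?divr_gt0//.
    by rewrite gtr_pMr ?invf_lt1// ltr1n.
  by rewrite lerBrDr gerDl leNgt divr_gt0.
- move=> h; have /nbhs_ballP[e /= e0 He] := cZ (open_ereal_lt' h).
  have [z Sz ze] : exists2 z, S z & z < nu + e.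
    by apply: inf_lt; rewrite // ltrDl.
  suff : (cdf Z z < alpha%:E)%E by rewrite ltNge Sz.
  apply: He; rewrite /ball/= distrC ger0_norm ?subr_ge0 ?ge_inf//.
  by rewrite ltrBlDl.
Qed.

Lemma prob_le_VaR : P [set w | Z w <= nu] = alpha%:E.
Proof. by rewrite -cdf_VaR. Qed.

Variable C : R.
Hypothesis ZC : forall w, `|Z w| <= C.

Let B := [set w | Z w <= nu].

Let mB : measurable B.
Proof.
rewrite (_ : B = Z @^-1` `]-oo, nu]); last first.
  by apply/seteqP; split=> w /=; rewrite in_itv.
by rewrite -[X in measurable X]setTI; exact: measurable_funP.
Qed.

Let CVaR_E : alpha * CVaR alpha Z = \int[P]_(w in B) Z w.
Proof.
by rewrite /CVaR /cond_expectation prob_le_VaR/= mulrC divfK ?gt_eqF.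
Qed.

(** Needed for every [v]: the equality case takes [v = nu], the inequality a threshold foreign to
    the law. *)
Let int_BB v :
  \int[P]_(w in B) (v - Z w) = alpha * v - alpha * CVaR alpha Z.
Proof.
rewrite RintegralB//; last 2 first.
- by apply: (@bounded_integrable _ _ _ P _ _ `|v|) => //.
- exact: (@bounded_integrable _ _ _ P _ _ C).
rewrite Rintegral_cst// CVaR_E mulrC; congr (_ * _ - _).
exact: (congr1 fine prob_le_VaR).
Qed.

(** The hinge is [nu - Z] on the event [B], of mass [alpha], and 0 off it. *)
Lemma CVaR_hinge :
  alpha * CVaR alpha Z = alpha * nu - \int[P]_w (Num.max (nu - Z w) 0).
Proof.
rewrite (_ : \int[P]_w _ = \int[P]_(w in B) (nu - Z w)).
  by rewrite int_BB opprB addrC subrK.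
rewrite [RHS]Rintegral_mkcond; apply: eq_Rintegral => w _; rewrite patchE.
case: ifPn => [/set_mem Bw|/negP wB]; first by apply: max_l; rewrite subr_ge0.
apply: max_r; rewrite subr_le0 leNgt; apply/negP => /ltW Zw.
by apply: wB; rewrite inE.
Qed.

(* The Rockafellar-Uryasev variational formula: by [CVaR_hinge] the supremum over
   [v] is attained at VaR. *)
Lemma CVaR_ge_hinge v :
  alpha * v - \int[P]_w (Num.max (v - Z w) 0) <= alpha * CVaR alpha Z.
Proof.
rewrite lerBlDr -lerBlDl -int_BB.
have mh : measurable_fun setT (fun w => Num.max (v - Z w) 0).
  by apply: measurable_maxr => //; exact: measurable_funB.
have hC w : `|Num.max (v - Z w) 0| <= `|v| + C by exact: ler_norm_hinge.
have ih A mA := @bounded_integrable _ _ _ P _ A _ mA mh hC.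
(* On [B] the hinge dominates [v - Z]; being nonnegative, it can only gain from integrating over the
   complement too. *)
apply: (@le_trans _ _ (\int[P]_(w in B) (Num.max (v - Z w) 0))).
  apply: le_Rintegral => //.
  - apply: (@bounded_integrable _ _ _ P _ _ (`|v| + C)) => // [|w].
      exact: measurable_funB.
    by rewrite (le_trans (ler_normB _ _))// lerD2l.
  - exact: ih.
  - by move=> w _; rewrite le_max lexx.
rewrite [leLHS]Rintegral_mkcond; apply: le_Rintegral => //.
- apply: (@bounded_integrable _ _ _ P _ _ (`|v| + C)) => // [|w].
    exact: (measurable_restrictT _ mB).1 (measurable_funTS mh).
  rewrite patchE; case: ifP => _; first exact: hC.
  by rewrite normr0 (le_trans _ (hC w)).
- exact: ih.
- by move=> w _; rewrite patchE; case: ifP => // _; rewrite le_max lexx orbT.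
Qed.

End value_at_risk_theory.

(** * Differentiation of CVaR in the parameter *)

Theorem proposition2 (R : realType) (alpha b : R)
    (halpha0 : 0 < alpha) (halpha1 : alpha < 1) (hb : 0 < b)
    (n k : nat) (calY : countType)
    (d : measure_display) (Omega : measurableType d)
    (P : 'rV[R]_k -> probability Omega R)
    (X : {mfun Omega >-> 'rV[R]_n}) (hX : forall w, cube b (X w))
    (Y : Omega -> calY) (hY : forall y, measurable (Y @^-1` [set y]))
    (fY : calY -> 'rV[R]_k -> R)
    (hfY : forall theta y, P theta (Y @^-1` [set y]) = (fY y theta)%:E)
    (fXY : 'rV[R]_n -> calY -> 'rV[R]_k -> R)
    (hfXY : forall theta y, is_cond_pdf (P theta) (cube b (n := n)) X
       (Y @^-1` [set y]) (fun x => fXY x y theta))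
    (r : 'rV[R]_n -> calY -> R)
    (hr_meas : forall y, measurable_fun (cube b (n := n)) (r ^~ y))
    (hr_bounded : exists C, forall x y, cube b x -> `|r x y| <= C)
    (Z : {mfun Omega >-> R}) (hZ : forall w, Z w = r (X w) (Y w))
    (nu := fun theta => VaR alpha (Z : {RV (P theta) >-> R}))
    (Phi := fun theta => CVaR alpha (Z : {RV (P theta) >-> R}))
    (hZ_cont : forall theta, continuous_rv (Z : {RV (P theta) >-> R}))
    (hnu : forall theta j, derivable nu theta (delta_mx ord0 j))
    (hnu_bounded : exists C, forall theta j, `|'partial_j nu theta| <= C)
    (hPhi : forall theta j, derivable Phi theta (delta_mx ord0 j))
    (hPhi_bounded : exists C, forall theta j, `|'partial_j Phi theta| <= C)
    (hfXY_gt0 : forall x y theta, cube b x -> 0 < fXY x y theta)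
    (hfXY_log : forall x y theta j, cube b x ->
       derivable (fun t => ln (fXY x y t)) theta (delta_mx ord0 j))
    (hfXY_log_bounded : exists C, forall x y theta j, cube b x ->
       `|'partial_j (fun t => ln (fXY x y t)) theta| <= C)
    (hfY_gt0 : forall y theta, 0 < fY y theta)
    (hfY_log : forall y theta j,
       derivable (fun t => ln (fY y t)) theta (delta_mx ord0 j))
    (hfY_log_bounded : exists C, forall y theta j,
       `|'partial_j (fun t => ln (fY y t)) theta| <= C)
    (hlevel : forall y theta,
       has_closed_components [set x | cube b x /\ r x y <= nu theta]) :
  forall theta j,
    'partial_j Phi theta =
    cond_expectation (P theta)
      (fun w => ('partial_j (fun t => ln (fY (Y w) t)) theta +
                 'partial_j (fun t => ln (fXY (X w) (Y w) t)) theta) *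
                (Z w - nu theta))
      [set w | Z w <= nu theta].
Proof.
move=> theta j.
have [C1 rC] := hr_bounded.
have ZC w : `|Z w| <= C1 by rewrite hZ; exact: rC.
have [Cx fXYC] := hfXY_log_bounded.
have [Cy fYC] := hfY_log_bounded.
pose e : 'rV[R]_k := delta_mx ord0 j.
(* The joint log-likelihood; its derivative along [e] is the sum of the two scores in the claim. *)
pose l x y (t : 'rV[R]_k) := ln (fY y t) + ln (fXY x y t).
have dl x y t : cube b x -> derivable (l x y) t e.
  by move=> bx; apply: derivableD; [exact: hfY_log|exact: hfXY_log].
have lE x y t : cube b x -> 'D_e (l x y) t =
    'partial_j (fun t => ln (fY y t)) t + 'partial_j (fun t => ln (fXY x y t)) t.
  by move=> bx; rewrite /l deriveD; [|exact: hfY_log|exact: hfXY_log].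
have lC x y t : cube b x -> `|'D_e (l x y) t| <= Cy + Cx.
  move=> bx; rewrite lE//; apply: (le_trans (ler_normD _ _)).
  by apply: lerD; [exact: fYC|exact: fXYC].
have mcube := @measurable_cube R b n.
set v := nu theta.
pose W w := Num.max (v - Z w) 0.
pose K t := \int[P t]_w W w.
pose score w := 'D_e (l (X w) (Y w)) theta.
pose S := \int[P theta]_w (W w * score w).
have mW : measurable_fun setT W.
  by apply: measurable_maxr => //; exact: measurable_funB.
have W0 w : 0 <= W w by rewrite le_max lexx orbT.
(* The likelihood ratio of [P t] to [P theta], equal to 1 at [t = theta]; hence the [- 1] in [q]
   below. *)
pose LR t w := expR (l (X w) (Y w) t - l (X w) (Y w) theta).
have mLR t : measurable_fun setT (LR t).
  have mln s : measurable_fun setT (fun w => l (X w) (Y w) s).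
    apply: (measurable_fun_mixed (F := fun x y => l x y s) mcube hX hY) => y.
    apply: measurable_funD => //; apply: measurableT_comp => //.
    by case: (hfXY s y).
  by apply: measurableT_comp => //; exact: measurable_funB.
have KE t : K t = \int[P theta]_w (W w * LR t w).
  congr fine; rewrite /LR /l.
  pose G x y := Num.max (v - r x y) 0.
  have GE w : W w = G (X w) (Y w) by rewrite /W hZ.
  under eq_integral do rewrite GE.
  under [RHS]eq_integral do rewrite GE.
  apply: (likelihood_ratio mcube hX hY (P := P theta) (p := fY ^~ theta)
    (q := fY ^~ t) (f := fun x y => fXY x y theta)
    (g := fun x y => fXY x y t) (G := G)) => //.
  - by move=> x y; exact: hfXY_gt0.
  - by move=> x y; exact: hfXY_gt0.
  - by move=> y; apply: measurable_maxr => //; exact: measurable_funB.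
  - by move=> x y _; rewrite le_max lexx orbT.
have KtE : K theta = \int[P theta]_w W w by [].
pose q (c : R) w := c^-1 * (LR (c *: e + theta) w - 1).
have mq c : measurable_fun setT (q c).
  by apply: measurable_funM => //; exact: measurable_funB.
have cvg_q (h : R^nat) w : h @ \oo --> 0 -> (forall m, h m != 0) ->
    q (h m) w @[m --> \oo] --> score w.
  by move=> h0 hn0; apply: cvg_expR_difference_quotient => //; exact: dl.
have WC w : `|W w| <= `|v| + C1 by exact: ler_norm_hinge.
pose M := Cy + Cx.
(* Differentiation of [K] under the expectation, along sequences; [|h m| <= 1] makes the bound on
   the quotients uniform in [m]. *)
have cvgK (h : R^nat) : h @ \oo --> 0 -> (forall m, h m != 0) ->
    (forall m, `|h m| <= 1) ->
    (h m)^-1 * (K (h m *: e + theta) - K theta) @[m --> \oo] --> S.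
  move=> h0 hn0 h1.
  have qC m w : `|q (h m) w| <= M * expR M.
    apply: expR_difference_quotient_bound => // [t|t]; first exact: dl.
    exact: lC.
  have WqC m w : `|W w * q (h m) w| <= (`|v| + C1) * (M * expR M).
    by rewrite normrM ler_pM.
  rewrite (_ : (fun m => _) = (fun m => \int[P theta]_w (W w * q (h m) w))).
    apply: (cvg_Rintegral_bounded _ _ WqC) => [m|w].
      exact: measurable_funM.
    by apply: cvgMl_tmp; exact: cvg_q.
  apply/funext => m; rewrite KE KtE.
  have iW : (P theta).-integrable setT (EFin \o W) by exact: bounded_integrable WC.
  have iWq : (P theta).-integrable setT (EFin \o (fun w => W w * q (h m) w)).
    by apply: bounded_integrable (WqC m) => //; exact: measurable_funM.
  (* As [h m] is nonzero, [LR = h m * q (h m) + 1], which isolates the increment of [K]. *)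
  have -> : \int[P theta]_w (W w * LR (h m *: e + theta) w) =
      \int[P theta]_w (h m * (W w * q (h m) w) + W w).
    by apply: eq_Rintegral => w _; rewrite /q; field.
  rewrite RintegralD//; last first.
    by apply: eq_integrable (integrableZl measurableT (h m) iWq).
  by rewrite RintegralZl// addrK mulKf.
(* Subtract the equality at [theta] from the inequality at [t], both with threshold [v]. *)
have PhiK t : alpha * (Phi t - Phi theta) >= - (K t - K theta).
  have := CVaR_hinge halpha0 halpha1 (hZ_cont theta) ZC.
  rewrite -/(Phi theta) -/(nu theta) -/v -/(K theta) => E.
  have := CVaR_ge_hinge halpha0 halpha1 (hZ_cont t) ZC v.
  rewrite -/(Phi t) -/(K t) => H.
  by rewrite mulrBr E; lra.
(* Increments [1 / (m + 1)] and their opposites: [PhiK] divided by a positive or a negative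
   increment gives opposite inequalities in the limit. *)
have hh0 := @cvg_harmonic R.
have hhn0 m : @harmonic R m != 0 by rewrite gt_eqF// harmonic_gt0.
have hh1 m : `|@harmonic R m| <= 1.
  by rewrite ger0_norm ?harmonic_ge0// /harmonic/= invf_le1// ler1n.
have hN0 : (fun m => - @harmonic R m) @ \oo --> 0.
  by rewrite -[X in _ --> X]oppr0; exact: cvgN.
have hNn0 m : - @harmonic R m != 0 by rewrite oppr_eq0.
have hN1 m : `|- @harmonic R m| <= 1 by rewrite normrN.
have dPhi := hPhi theta j.
have main : alpha * 'D_e Phi theta = - S.
  have quotP (u x y : R) : 0 <= u -> - y <= alpha * x ->
      - (u * y) <= alpha * (u * x).
    by move=> u0 yx; rewrite -mulrN mulrCA ler_wpM2l.
  have quotN (u x y : R) : u <= 0 -> - y <= alpha * x ->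
      alpha * (u * x) <= - (u * y).
    by move=> u0 yx; rewrite -mulrN mulrCA ler_wnM2l.
  apply/eqP; rewrite eq_le; apply/andP; split.
    (* Negative increments give the upper bound; the positive ones below give the lower bound. *)
    have c1 := cvgMl_tmp (a := alpha) (cvg_difference_quotient dPhi hN0 hNn0).
    have c2 := cvgN (cvgK _ hN0 hNn0 hN1).
    apply: (ler_cvg_to (c1 _) (c2 _)); apply: nearW => m.
    have u0 : (- @harmonic R m)^-1 <= 0.
      by rewrite invr_le0 oppr_le0 harmonic_ge0.
    exact: (quotN _ _ _ u0 (PhiK _)).
  have c1 := cvgN (cvgK _ hh0 hhn0 hh1).
  have c2 := cvgMl_tmp (a := alpha) (cvg_difference_quotient dPhi hh0 hhn0).
  apply: (ler_cvg_to (c1 _) (c2 _)); apply: nearW => m.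
  have u0 : 0 <= (@harmonic R m)^-1 by rewrite invr_ge0 harmonic_ge0.
  exact: (quotP _ _ _ u0 (PhiK _)).
(* The conditioning event has mass [alpha], so multiplying by [alpha] clears the denominator. *)
rewrite /cond_expectation prob_le_VaR//= -/e.
apply: (@mulfI _ alpha); first by rewrite gt_eqF.
rewrite main [RHS]mulrC divfK ?gt_eqF//.
rewrite [RHS]Rintegral_mkcond.
(* The score is measurable as a pointwise limit of the measurable quotients [q]. *)
have mscore : measurable_fun setT score.
  by apply: (measurable_fun_cvg (fun m => mq (harmonic m))) => w _; exact: cvg_q.
have iWs : (P theta).-integrable setT (EFin \o (fun w => W w * score w)).
  apply: (@bounded_integrable _ _ _ (P theta) _ _ ((`|v| + C1) * M)) => // [|w].
    exact: measurable_funM.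
  by rewrite normrM ler_pM// lC.
(* Pointwise, [- W] is [Z - v] on the conditioning event and 0 elsewhere. *)
rewrite -mulN1r -RintegralZl//; apply: eq_Rintegral => w _.
rewrite patchE /score lE// mulN1r -mulNr mulrC.
case: ifPn => [/set_mem/= Zw|/negP Zw].
  by rewrite /W max_l ?opprB// subr_ge0.
rewrite /W max_r ?oppr0 ?mulr0//.
rewrite subr_le0 leNgt; apply/negP => /ltW Zw'; apply: Zw.
by rewrite inE.
Qed.
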